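(* Consider the 1D special relativistic hydrodynamics (RHD) system with a Synge-type equation of state $h=h(\theta)=1+e(\theta)+\theta$, $\theta=p/\rho$, satisfying $e'(\theta)>0$ and $h(\theta)>\theta(1+e'(\theta))/e'(\theta)$ for all $\theta>0$, and the semi-discrete scheme $$\frac{d}{dt}\mathbf U_i(t)+\frac{\widehat{\mathbf F}_{i+\frac12}(t)-\widehat{\mathbf F}_{i-\frac12}(t)}{\Delta x}=0,\qquad \widehat{\mathbf F}_{i+\frac12}=\widetilde{\mathbf F}^{EC}_1(\mathbf U_i,\mathbf U_{i+1})-\frac12\mathbf D_{i+\frac12}[\![\mathbf W]\!]_{i+\frac12},$$ with the Roe-type dissipation matrix $\mathbf D_{i+\frac12}=\mathbf R_{i+\frac12}|\boldsymbol\Lambda_{i+\frac12}|\mathbf R_{i+\frac12}^\top$ evaluated at averaged interface states. Assume that the averaged specific enthalpy $h_{i+\frac12}$ in $\mathbf D_{i+\frac12}$ satisfies $$h_{i+\frac12}=\mathcal E_{i+\frac12}+\frac{1}{\{\!\{z_2\}\!\}_{\ln,i+\frac12}},\qquad z_2=\frac{\rho}{p}=\frac1\theta .$$ Then the scheme exactly resolves stationary contact discontinuities.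
   Context: RHD system: $\partial_t\mathbf U+\partial_x\mathbf F_1(\mathbf U)=\mathbf 0$ with $\mathbf U=(D,m_1,E)^\top$, $\mathbf F_1=(Dv_1,\ v_1m_1+p,\ m_1)^\top$, $D=\rho\gamma$, $m_1=\rho h\gamma^2v_1$, $E=\rho h\gamma^2-p$, where $\rho>0$, $p>0$, $|v_1|<1$, $\gamma=(1-v_1^2)^{-1/2}$, $\theta=p/\rho$; $e$ is continuously differentiable on $(0,\infty)$. With $S=-\ln\rho+\int^\theta\frac{e'(x)}{x}dx$ (a fixed antiderivative), the entropy variables are $\mathbf W=(W_1,W_2,W_3)^\top=\frac1\theta(h-\theta S,\gamma v_1,-\gamma)^\top$. Notation: at the interface $i+\frac12$ between states $\mathbf U_i$ (left, $L$) and $\mathbf U_{i+1}$ (right, $R$), $[\![a]\!]=a_R-a_L$, $\{\!\{a\}\!\}=\frac12(a_L+a_R)$, $\{\!\{a\}\!\}_{\ln}=[\![a]\!]/[\![\ln a]\!]$ (equal to $a_L$ if $a_L=a_R$). Put $z_1=\rho$, $z_2=\rho/p$, $z_3=\gamma v_1$, and $$\mathcal E=\frac{[\![W_1]\!]-[\![\ln z_1]\!]}{[\![z_2]\!]}=1+\int_0^1e\Bigl(\tfrac{1}{z_{2,L}+s(z_{2,R}-z_{2,L})}\Bigr)ds$$ (the integral formula being used if $[\![z_2]\!]=0$). Entropy conservative flux: $\widetilde{\mathbf F}^{EC}_1=\bigl(\{\!\{z_1\}\!\}_{\ln}\{\!\{z_3\}\!\},\ \widehat{\rho h}\{\!\{z_3\}\!\}^2+\frac{\{\!\{z_1\}\!\}}{\{\!\{z_2\}\!\}},\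 \widehat{\rho h}\{\!\{\gamma\}\!\}\{\!\{z_3\}\!\}\bigr)^\top$ with $\widehat{\rho h}=\Bigl(\frac{\{\!\{z_1\}\!\}}{\{\!\{z_2\}\!\}}+\{\!\{z_1\}\!\}_{\ln}\mathcal E\Bigr)\big/\bigl(\{\!\{\gamma\}\!\}^2-\{\!\{z_3\}\!\}^2\bigr)$. Dissipation matrix: $|\boldsymbol\Lambda|=\mathrm{diag}\{|\lambda_1|,|\lambda_2|,|\lambda_3|\}$ (Roe type) with $\lambda_1=\frac{v_1-c_s}{1-v_1c_s}$, $\lambda_2=v_1$, $\lambda_3=\frac{v_1+c_s}{1+v_1c_s}$, $c_s=\sqrt{\frac{\theta(1+e'(\theta))}{he'(\theta)}}$, and $$\mathbf R=\begin{pmatrix}1&1&1\\ (v_1-c_s)h\gamma&(h-\theta(1+e'(\theta)))\gamma v_1&(v_1+c_s)h\gamma\\ (1-v_1c_s)h\gamma&(h-\theta(1+e'(\theta)))\gamma&(1+v_1c_s)h\gamma\end{pmatrix}\mathrm{diag}\{\sqrt{d_1},\sqrt{d_2},\sqrt{d_3}\},$$ $d_1=\bigl(\frac{\rho e'(\theta)}{2(1+e'(\theta))}-\frac{\rho\theta v_1}{2c_sh}\bigr)\gamma$, $d_2=\frac{\rho\gamma}{1+e'(\theta)}$, $d_3=\bigl(\frac{\rho e'(\theta)}{2(1+e'(\theta))}+\frac{\rho\theta v_1}{2c_sh}\bigr)\gamma$. In $\mathbf R_{i+\frac12}$ and $\boldsymbol\Lambda_{i+\frac12}$ the quantity $h$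 is replaced by $h_{i+\frac12}$, and $\theta,\rho,v_1$ by interface averages $\theta_{i+\frac12}>0$, $\rho_{i+\frac12}>0$, $(v_1)_{i+\frac12}$ of the two neighbouring states (the paper takes $\theta_{i+\frac12}=1/\{\!\{z_2\}\!\}_{\ln}$, $\rho_{i+\frac12}=\{\!\{\rho\}\!\}_{\ln}$, $(v_1)_{i+\frac12}=\{\!\{v_1\}\!\}$, so $(v_1)_{i+\frac12}=0$ when both velocities vanish); $c_s,\gamma,e'(\theta)$ are computed from the averaged states. A stationary contact discontinuity is the data $\rho=\rho_L$ for $x<0$, $\rho=\rho_R$ for $x>0$ ($\rho_L,\rho_R>0$ constants), $v_1=0$, $p=\text{const}>0$. The scheme exactly resolves it if, for grid data $\mathbf U_i$ sampled from it, $\widehat{\mathbf F}_{i+\frac12}=(0,p,0)^\top$ for all $i$ (equivalently $\mathbf D_{i+\frac12}[\![\mathbf W]\!]_{i+\frac12}=\mathbf 0$ for all $i$), so that the discrete data are stationary. *)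

(* Defs.v *)
From HB Require Import structures.
From mathcomp Require Import all_boot all_order all_algebra.
From mathcomp Require Import all_classical all_reals all_analysis.
From mathcomp Require Import ring lra.
Set Implicit Arguments.
Unset Strict Implicit.
Unset Printing Implicit Defensive.
Import Order.TTheory GRing.Theory Num.Theory.
Import numFieldNormedType.Exports.
Local Open Scope ring_scope.
Local Open Scope classical_set_scope.

(* Throughout, [e] is the internal energy as a function of theta = p / rho and
   [G] is the chosen antiderivative of x |-> e'(x) / x on ]0, +oo[. *)

Definition cvec3 (R : realType) (a b c : R) : 'cV[R]_3 :=
  \col_(i < 3) [:: a; b; c]`_i.

(* A state is stored through its primitive variables (rho, v_1, p); the
   conservative vector U is [conserved]. *)
Record state (R : realType) := State { rho : R; vel : R; prs : R }.

Definition physical (R : realType) (U : state R) : Prop :=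
  [/\ 0 < rho U, 0 < prs U & `|vel U| < 1].

Definition lorentz (R : realType) (v : R) : R := (Num.sqrt (1 - v ^+ 2))^-1.

Definition temp (R : realType) (U : state R) : R := prs U / rho U.

Definition enthalpy (R : realType) (e : R -> R) (theta : R) : R :=
  1 + e theta + theta.

Definition synge_type_eos (R : realType) (e : R -> R) : Prop :=
  forall theta : R, 0 < theta ->
    [/\ derivable e theta 1,
        {for theta, continuous (derive1 e)},
        0 < derive1 e theta &
        theta * (1 + derive1 e theta) / derive1 e theta < enthalpy e theta].

Definition entropy_antiderivative (R : realType) (e G : R -> R) : Prop :=
  forall x : R, 0 < x -> is_derive x 1 G (derive1 e x / x).

Definition conserved (R : realType) (e : R -> R) (U : state R) : 'cV[R]_3 :=
  let h := enthalpy e (temp U) in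
  let g := lorentz (vel U) in
  cvec3 (rho U * g) (rho U * h * g ^+ 2 * vel U)
        (rho U * h * g ^+ 2 - prs U).

Definition entropyS (R : realType) (G : R -> R) (U : state R) : R :=
  - ln (rho U) + G (temp U).

Definition entropyW (R : realType) (e G : R -> R) (U : state R) : 'cV[R]_3 :=
  let theta := temp U in
  let g := lorentz (vel U) in
  theta^-1 *: cvec3 (enthalpy e theta - theta * entropyS G U)
                    (g * vel U) (- g).

Definition mean (R : realType) (a b : R) : R := (a + b) / 2.

Definition log_mean (R : realType) (a b : R) : R :=
  if a == b then a else (b - a) / (ln b - ln a).

Definition z1 (R : realType) (U : state R) : R := rho U.
Definition z2 (R : realType) (U : state R) : R := rho U / prs U.
Definition z3 (R : realType) (U : state R) : R := lorentz (vel U) * vel U.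

Definition calE (R : realType) (e G : R -> R) (UL UR : state R) : R :=
  let W1 U := entropyW e G U 0 0 in
  if z2 UR - z2 UL == 0
  then 1 + \int[lebesgue_measure]_(s in `[0, 1])
             e ((z2 UL + s * (z2 UR - z2 UL))^-1)
  else ((W1 UR - W1 UL) - (ln (z1 UR) - ln (z1 UL))) / (z2 UR - z2 UL).

Definition fluxEC (R : realType) (e G : R -> R) (UL UR : state R) : 'cV[R]_3 :=
  let z1m := mean (z1 UL) (z1 UR) in
  let z1ln := log_mean (z1 UL) (z1 UR) in
  let z2m := mean (z2 UL) (z2 UR) in
  let z3m := mean (z3 UL) (z3 UR) in
  let gm := mean (lorentz (vel UL)) (lorentz (vel UR)) in
  let rhoh := (z1m / z2m + z1ln * calE e G UL UR) / (gm ^+ 2 - z3m ^+ 2) in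
  cvec3 (z1ln * z3m) (rhoh * z3m ^+ 2 + z1m / z2m) (rhoh * gm * z3m).

(* Each field maps the left and right states to their interface average. *)
Record averages (R : realType) := Averages {
  rho_av : state R -> state R -> R;
  vel_av : state R -> state R -> R;
  theta_av : state R -> state R -> R;
  h_av : state R -> state R -> R }.

Definition admissible_averages (R : realType) (A : averages R) : Prop :=
  forall UL UR : state R, physical UL -> physical UR ->
    [/\ 0 < rho_av A UL UR, 0 < theta_av A UL UR, `|vel_av A UL UR| < 1 &
        vel UL = 0 -> vel UR = 0 -> vel_av A UL UR = 0].

(* In the next three definitions h is an independent argument: at an interface
   it is not the value of [enthalpy] at the averaged theta. *)
Definition sound_speed (R : realType) (e : R -> R) (theta h : R) : R :=
  Num.sqrt (theta * (1 + derive1 e theta) / (h * derive1 e theta)).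

Definition absLambda (R : realType) (e : R -> R) (theta v h : R) : 'M[R]_3 :=
  let c := sound_speed e theta h in
  diag_mx (cvec3 `|(v - c) / (1 - v * c)| `|v| `|(v + c) / (1 + v * c)|)^T.

Definition eigenvectors (R : realType) (e : R -> R) (rho theta v h : R) :
    'M[R]_3 :=
  let c := sound_speed e theta h in
  let g := lorentz v in
  let de : R := derive1 e theta in
  let k := h - theta * (1 + de) in
  let d1 := (rho * de / (2 * (1 + de)) - rho * theta * v / (2 * c * h)) * g in
  let d2 := rho * g / (1 + de) in
  let d3 := (rho * de / (2 * (1 + de)) + rho * theta * v / (2 * c * h)) * g in
  (\matrix_(i < 3, j < 3)
     (nth [::] [:: [:: 1; 1; 1];
         [:: (v - c) * h * g; k * g * v; (v + c) * h * g];
         [:: (1 - v * c) * h * g; k * g; (1 + v * c) * h * g]] i)`_j)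
  *m diag_mx (cvec3 (Num.sqrt d1) (Num.sqrt d2) (Num.sqrt d3))^T.

Definition dissipation (R : realType) (e : R -> R) (A : averages R)
    (UL UR : state R) : 'M[R]_3 :=
  let r := rho_av A UL UR in
  let th := theta_av A UL UR in
  let v := vel_av A UL UR in
  let h := h_av A UL UR in
  let Rm := eigenvectors e r th v h in
  Rm *m absLambda e th v h *m Rm^T.

Definition num_flux (R : realType) (e G : R -> R) (A : averages R)
    (UL UR : state R) : 'cV[R]_3 :=
  fluxEC e G UL UR -
  2^-1 *: (dissipation e A UL UR *m (entropyW e G UR - entropyW e G UL)).

(* [U i t] is the state in cell i at time t on a uniform mesh of width dx. *)
Definition solves_scheme (R : realType) (e G : R -> R) (A : averages R)
    (dx : R) (U : int -> R -> state R) : Prop :=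
  forall (i : int) (t : R),
    is_derive t (1 : R) (fun s : R => conserved e (U i s))
      (- (dx^-1 *: (num_flux e G A (U i t) (U (i + 1) t) -
                    num_flux e G A (U (i - 1) t) (U i t)))).

(* At the jump itself the profile may take either of the two values. *)
Definition stationary_contact (R : realType) (rhoL rhoR p : R)
    (u : R -> state R) : Prop :=
  [/\ forall x, x < 0 -> u x = State rhoL 0 p,
      forall x, 0 < x -> u x = State rhoR 0 p &
      u 0 = State rhoL 0 p \/ u 0 = State rhoR 0 p].

(* The cells are centred at x0 + i dx, with x0 arbitrary. *)
Definition exactly_resolves_contacts (R : realType) (e G : R -> R)
    (A : averages R) : Prop :=
  forall (rhoL rhoR p : R) (u : R -> state R) (x0 dx : R),
    0 < rhoL -> 0 < rhoR -> 0 < p -> 0 < dx ->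
    stationary_contact rhoL rhoR p u ->
    let U (i : int) := u (x0 + i%:~R * dx) in
    (forall i : int, num_flux e G A (U i) (U (i + 1)) = cvec3 0 p 0) /\
    solves_scheme e G A dx (fun i _ => U i).

(* The choice theta = 1 / {{z2}}_ln, rho = {{rho}}_ln, v_1 = {{v_1}}; it shows
   that the conditions imposed on [averages] can be met. *)
Definition log_averages (R : realType) (e G : R -> R) : averages R :=
  {| rho_av := fun UL UR => log_mean (rho UL) (rho UR);
     vel_av := fun UL UR => mean (vel UL) (vel UR);
     theta_av := fun UL UR => (log_mean (z2 UL) (z2 UR))^-1;
     h_av := fun UL UR => calE e G UL UR + (log_mean (z2 UL) (z2 UR))^-1 |}.

Lemma log_mean_gt0 (R : realType) (a b : R) :
  0 < a -> 0 < b -> 0 < log_mean a b.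
Proof.
move=> a0 b0; rewrite /log_mean; case: eqVneq => // /lt_total/orP[ab|ba].
- by apply: divr_gt0; rewrite subr_gt0 ?ltr_ln ?posrE.
- by rewrite -mulrNN -invrN !opprB; apply: divr_gt0;
    rewrite subr_gt0 ?ltr_ln ?posrE.
Qed.

Lemma log_averages_admissible (R : realType) (e G : R -> R) :
  admissible_averages (log_averages e G).
Proof.
move=> UL UR [rL pL vL] [rR pR vR]; split => /=.
- exact: log_mean_gt0.
- by rewrite invr_gt0 log_mean_gt0// /z2 divr_gt0.
- by move: vL vR; rewrite /mean !ltr_norml => /andP[? ?] /andP[? ?]; lra.
- by rewrite /mean => -> ->; rewrite addr0 mul0r.
Qed.

(* Main.v *)
Require Import Defs.
From mathcomp Require Import all_boot all_order all_algebra.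
From mathcomp Require Import all_classical all_reals all_analysis.
From mathcomp Require Import ring.
Import Order.TTheory GRing.Theory Num.Theory.
Import numFieldNormedType.Exports.
Local Open Scope ring_scope.

(** Across a contact at rest both the velocity and the pressure p are
    continuous, so [rho] is the only quantity that jumps.  The entropy
    conservative flux is then already the exact one, since the means of rho and
    of rho / p have quotient p ([fluxEC_contact]); it remains to see that the
    dissipation adds nothing.

    Because z2 = rho / p with p constant, ln rho and ln z2 have the same jump,
    and the definition of E ([calE]) as a difference quotient in z2 gives
      [[W1]] = E [[z2]] + [[ln z2]] = (E + 1 / {{z2}}_ln) [[z2]].
    Hence [[W]] = [[z2]] (H, 0, -1) with H = E + 1 / {{z2}}_ln
    ([entropyW_contact_jump]).  At zero velocity the two acoustic eigenvectors
    are, up to scaling, (1, -c h, h) and (1, c h, h); both are orthogonal to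
    (h, 0, -1).  The remaining eigenvector, that of the contact wave, need not
    be orthogonal to it, but its eigenvalue |v| vanishes.  So
    |Lambda| R^T kills (h, 0, -1) ([absLambda_eigenvectors_contact]), and the
    prescribed choice of the averaged enthalpy is precisely h = H.  *)

Lemma lorentz0 (R : realType) : lorentz (0 : R) = 1.
Proof. by rewrite /lorentz expr0n subr0 sqrtr1 invr1. Qed.

Lemma cvec3P (R : realType) (u w : 'cV[R]_3) :
  u 0 0 = w 0 0 -> u 1 0 = w 1 0 -> u 2%:R 0 = w 2%:R 0 -> u = w.
Proof.
move=> h0 h1 h2; apply/matrixP => i j; rewrite (ord1 j).
case: i => -[|[|[|//]]] i3.
- by rewrite (_ : Ordinal i3 = 0)//; exact/val_inj.
- by rewrite (_ : Ordinal i3 = 1)//; exact/val_inj.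
- by rewrite (_ : Ordinal i3 = 2%:R)//; exact/val_inj.
Qed.

Lemma fluxEC_contact (R : realType) (e G : R -> R) (a b p : R) :
  0 < a -> 0 < b -> 0 < p ->
  fluxEC e G (State a 0 p) (State b 0 p) = cvec3 0 p 0.
Proof.
move=> a0 b0 p0; rewrite /fluxEC /z1 /z2 /z3 /mean /= !mulr0 addr0 mul0r.
have ab0 : a + b != 0 by rewrite gt_eqF// addr_gt0.
have -> : (a + b) / 2 / ((a / p + b / p) / 2) = p.
  by field; rewrite ab0 gt_eqF.
by rewrite expr0n !mulr0 add0r.
Qed.

(** The factor of z2's jump is the entropy direction of the contact; its first
    entry is the averaged enthalpy for which the dissipation vanishes.  The case
    of equal densities, where [calE] and [log_mean] are defined by other
    formulas, is trivial as both jumps are zero. *)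
Lemma entropyW_contact_jump (R : realType) (e G : R -> R) (a b p : R) :
  0 < a -> 0 < b -> 0 < p ->
  let UL := State a 0 p in let UR := State b 0 p in
  entropyW e G UR - entropyW e G UL =
  (z2 UR - z2 UL) *:
    cvec3 (calE e G UL UR + (log_mean (z2 UL) (z2 UR))^-1) 0 (-1).
Proof.
move=> a0 b0 p0 UL UR.
have [ab|ab] := eqVneq a b.
  by rewrite /UL /UR ab !subrr scale0r.
have z2D : z2 UR - z2 UL != 0.
  rewrite /z2 /= -mulrBl mulf_neq0//; first by rewrite subr_eq0 eq_sym.
  by rewrite invr_neq0// gt_eqF.
have z2N : z2 UL != z2 UR by rewrite eq_sym -subr_eq0.
have lnz2 : ln (z2 UR) - ln (z2 UL) = ln b - ln a.
  rewrite /z2 /= !ln_div ?posrE//; ring.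
apply: cvec3P.
- rewrite [RHS]mxE /calE (negbTE z2D) /log_mean (negbTE z2N) lnz2 invf_div.
  by rewrite /cvec3 ![in RHS]mxE /= -mulrDl mulrC divfK// subrK !mxE.
- by rewrite /entropyW !mxE /= !mulr0 subrr.
- by rewrite /entropyW !mxE /= lorentz0 /temp /z2 /= !invf_div; ring.
Qed.

(** Acoustic rows vanish by orthogonality of the eigenvectors, the contact row
    because its eigenvalue is the velocity. *)
Lemma absLambda_eigenvectors_contact (R : realType) (e : R -> R)
    (r th h : R) :
  absLambda e th 0 h *m ((eigenvectors e r th 0 h)^T *m cvec3 h 0 (-1)) = 0.
Proof.
rewrite /eigenvectors trmx_mul tr_diag_mx -mulmxA /absLambda.
rewrite !mul_diag_mx lorentz0.
apply: cvec3P; rewrite !mxE /= ?normr0 ?mul0r// !big_ord_recl big_ord0 !mxE /=;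
  ring.
Qed.

Lemma num_flux_contact (R : realType) (e G : R -> R) (A : averages R)
    (a b p : R) :
  let UL := State a 0 p in let UR := State b 0 p in
  0 < a -> 0 < b -> 0 < p -> vel_av A UL UR = 0 ->
  h_av A UL UR = calE e G UL UR + (log_mean (z2 UL) (z2 UR))^-1 ->
  num_flux e G A UL UR = cvec3 0 p 0.
Proof.
move=> UL UR a0 b0 p0 v0 hE.
rewrite /num_flux fluxEC_contact// entropyW_contact_jump// -hE.
rewrite /dissipation v0 -scalemxAr -!mulmxA absLambda_eigenvectors_contact.
by rewrite !mulmx0 !scaler0 subr0.
Qed.

Theorem theorem7 (R : realType) (e G : R -> R) (A : averages R)
    (he : synge_type_eos e) (hG : entropy_antiderivative e G)
    (hA : admissible_averages A)
    (hh : forall UL UR : state R, physical UL -> physical UR ->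
       h_av A UL UR = calE e G UL UR + (log_mean (z2 UL) (z2 UR))^-1) :
  exactly_resolves_contacts e G A.
Proof.
move=> rhoL rhoR p u x0 dx rL0 rR0 p0 _ [uL uR u0] U.
have UE i : exists2 r, 0 < r & U i = State r 0 p.
  rewrite /U; have [/uL ->|/uR ->|->] := ltgtP (x0 + i%:~R * dx) 0.
  - by exists rhoL.
  - by exists rhoR.
  - by case: u0 => ->; [exists rhoL|exists rhoR].
have phys r : 0 < r -> physical (State r 0 p).
  by move=> r0; split => //=; rewrite normr0 ltr01.
have flux i j : num_flux e G A (U i) (U j) = cvec3 0 p 0.
  have [a a0 ->] := UE i; have [b b0 ->] := UE j.
  have [_ _ _ v0] := hA _ _ (phys _ a0) (phys _ b0).
  apply: num_flux_contact => //; first exact: v0.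
  exact: hh (phys _ a0) (phys _ b0).
split=> [i|i t]; first exact: flux.
by rewrite !flux subrr scaler0 oppr0; exact: is_derive_cst.
Qed.
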